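(* Let $K$ be a field, $S=K[x_1,\ldots,x_n]$ the standard graded polynomial ring, $I\subset S$ a graded ideal contained in $(x_1,\ldots,x_n)$ of codimension $s$, $R=S/I$, and let $\mathbf{f}=f_1,\ldots,f_m$ be a homogeneous regular sequence of $R$. Write $(I,\mathbf{f})\subset S$ for the graded ideal with $S/(I,\mathbf{f})=R/(\mathbf{f})$. Suppose that $$\frac{1}{s!}\prod_{i=1}^s m_i(I)\;\leq\; e(R)\;\leq\;\frac{1}{s!}\prod_{i=1}^s M_i(I).$$ Then $$\frac{1}{(s+m)!}\prod_{i=1}^{s+m} m_i(I,\mathbf{f})\;\leq\; e(R/(\mathbf{f}))\;\leq\;\frac{1}{(s+m)!}\prod_{i=1}^{s+m} M_i(I,\mathbf{f}).$$
   Context: For a graded ideal $L\subset S$ contained in $(x_1,\ldots,x_n)$, let $$0\to\bigoplus_{j=1}^{b_p} S(-d_{pj})\to\cdots\to\bigoplus_{j=1}^{b_1} S(-d_{1j})\to S\to 0$$ be the graded minimal free $S$-resolution of $S/L$, where $p$ is the projective dimension of $S/L$. For $i=1,\ldots,p$ set $M_i(L)=\max\{d_{ij} : j=1,\ldots,b_i\}$ and $m_i(L)=\min\{d_{ij}: j=1,\ldots,b_i\}$. The codimension of $L$ is its height, and $e(\cdot)$ denotes the multiplicity of a graded module. $S/L$ is not assumed to be Cohen-Macaulay. *)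

(* Defs.v *)
From mathcomp Require Import all_boot all_order all_algebra.
From mathcomp Require Import boolp.
From mathcomp Require Import mpoly.

Set Implicit Arguments.
Unset Strict Implicit.
Unset Printing Implicit Defensive.

Import GRing.Theory Num.Theory.

Local Open Scope ring_scope.

Section Ideals.
Variables (K : fieldType) (n : nat).
Local Notation S := {mpoly K[n]}.
Implicit Types (I L P : {pred S}) (f : seq S) (g : S).

(* The ideal (I, f) of S. *)
Definition adjoin I f : {pred S} := fun g =>
  `[< exists2 a : S, a \in I &
      exists h : nat -> S, g = a + \sum_(j < size f) h j * f`_j >].

(* The ideal (x_1, ..., x_n). *)
Definition irrelevant : {pred S} := adjoin (pred1 0) [seq 'X_i | i : 'I_n].

(* [idealr_closed] includes properness: 1 is not in I. *)
Definition graded_ideal I : Prop :=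
  idealr_closed I /\ (forall d g, g \in I -> pihomog mdeg d g \in I).

(* f is given by homogeneous lifts to S of the elements of R = S/I; the last
   condition is R/(f) <> 0, so no element of the sequence is a unit of R. *)
Definition homogeneous_regular_sequence I f : Prop :=
  [/\ forall i, (i < size f)%N -> exists d, f`_i \is d.-homog,
      forall i, (i < size f)%N ->
        forall g, f`_i * g \in adjoin I (take i f) -> g \in adjoin I (take i f)
    & 1 \notin adjoin I f].

Definition prime_ideal P : Prop := idealr_closed P /\ prime_idealr_closed P.

(* There is a chain c 0 < c 1 < ... < c h = P of prime ideals. *)
Definition prime_chain P (h : nat) : Prop :=
  exists c : nat -> {pred S},
    [/\ c h =i P,
        forall i, (i <= h)%N -> prime_ideal (c i)
      & forall i, (i < h)%N ->
          {subset c i <= c i.+1} /\ (exists2 g, g \in c i.+1 & g \notin c i)].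

Definition prime_height P (h : nat) : Prop :=
  prime_chain P h /\ (forall k, prime_chain P k -> (k <= h)%N).

Definition height I (s : nat) : Prop :=
  (exists P, [/\ prime_ideal P, {subset I <= P} & prime_height P s]) /\
  (forall P h, prime_ideal P -> {subset I <= P} -> prime_height P h ->
     (s <= h)%N).

(* h = dim_K (S/L)_k: the classes of the b i form a K-basis of (S/L)_k. *)
Definition quot_dim L (k h : nat) : Prop :=
  exists b : 'I_h -> S,
    [/\ forall i, b i \is k.-homog,
        forall c : 'I_h -> K, \sum_(i < h) c i *: b i \in L -> forall i, c i = 0
      & forall g, g \is k.-homog ->
          exists c : 'I_h -> K, g - \sum_(i < h) c i *: b i \in L].

Definition hilbert_function L (H : nat -> nat) : Prop :=
  forall k, quot_dim L k (H k).

(* e = e(S/L).  P is the Hilbert polynomial; if P <> 0, it has degree d - 1 with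
   d = dim S/L and e = (d - 1)! * lead_coef P.  If P = 0, i.e. d = 0, then e is
   the length of S/L. *)
Definition multiplicity L (e : rat) : Prop :=
  exists (H : nat -> nat) (P : {poly rat}) (k0 : nat),
    [/\ hilbert_function L H,
        forall k, (k0 <= k)%N -> (H k)%:R = P.[k%:R]
      & e = if P == 0 then (\sum_(k < k0) H k)%:R
            else ((size P).-1)`!%:R * lead_coef P].

(* A resolution is described by D : seq (seq nat), whose i-th term (counting
   from 1) lists the shifts d_i1, ..., d_ib_i of the module in homological degree
   i; the module in degree 0 is S, so that [shifts D 0] is [:: 0]. *)
Definition shifts (D : seq (seq nat)) (i : nat) : seq nat :=
  nth [::] ([:: 0%N] :: D) i.

(* D lists the shifts of a graded minimal free resolution of S/L, of length
   p = size D.  Elements of the free modules are row vectors and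
   phi i : F_(i+1) -> F_i acts by right multiplication; it is homogeneous of
   degree 0 iff its (j, k) entry is zero or homogeneous of degree
   d_(i+1)j - d_ik. *)
Definition minimal_free_resolution L (D : seq (seq nat)) : Prop :=
  [::] \notin D /\
  exists phi : forall i, 'M[S]_(size (shifts D i.+1), size (shifts D i)),
    [/\ forall i j k (u : 'X_{1..n}), u \in msupp (phi i j k) ->
          (mdeg u + nth 0%N (shifts D i) k)%N = nth 0%N (shifts D i.+1) j,
        forall i j k, phi i j k \in irrelevant,
        forall g, g \in L <->
          exists w : 'rV[S]_(size (shifts D 1)), w *m phi 0%N = g%:M
      & forall i (v : 'rV[S]_(size (shifts D i.+1))),
          v *m phi i = 0 <->
          exists w : 'rV[S]_(size (shifts D i.+2)), v = w *m phi i.+1].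

End Ideals.

Arguments irrelevant K n : clear implicits.

(* M_i and m_i, for 1 <= i <= size D; both are 0 for i > size D. *)
Definition max_shift (D : seq (seq nat)) (i : nat) : nat :=
  \max_(d <- shifts D i) d.

Definition min_shift (D : seq (seq nat)) (i : nat) : nat :=
  \big[minn/head 0%N (shifts D i)]_(d <- shifts D i) d.

(* Main.v *)
Require Import Defs.
From mathcomp Require Import all_boot all_order all_algebra.
From mathcomp Require Import boolp.
From mathcomp Require Import mpoly.
From mathcomp Require Import zify ring.

(** The theorem reduces to a regular sequence of one element by induction on the
    sequence, so let f be homogeneous of degree a and regular on S/L.  Since
    (L, f) is proper and f is regular, f is neither zero nor a unit, whence
    a > 0.

    Multiplicity.  Multiplication by f embeds (S/L)_(k-a) into (S/L)_k with
    cokernel (S/(L,f))_k, so the Hilbert function of S/(L, f) is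
    H(k) - H(k - a) ([quot_dim_adjoin]).  On Hilbert polynomials this is a
    backward difference, which lowers the degree by one and multiplies the
    normalized leading coefficient by a; when the difference is 0 the sum
    telescopes.  In every case e(S/(L, f)) = a e(S/L)
    ([multiplicity_adjoin]).

    Shifts.  The mapping cone of multiplication by f on a minimal free
    resolution of S/L is a minimal free resolution of S/(L, f)
    ([cone_resolves]): it is exact because f is regular, and minimal because
    a > 0.  Its shifts in degree i + 1 are those of S/L in degree i + 1
    together with a plus those in degree i.  As two minimal free resolutions
    have the same shifts ([shift_seq_uniq]), the shifts of any given minimal
    resolution of S/(I, f) may be read off the iterated cone.

    Numbers.  With x_i for M_i(L), x_0 = 0, and y_i for M_i(L, f), this gives
    y_i >= x_i and y_i >= x_(i-1) + a, and these inequalities imply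
      y_1 ... y_(s+1) >= (s + 1) a x_1 ... x_s,
    by induction on s ([leq_prod_of_step]).  Dividing by (s + 1)! turns the
    upper bound for e(S/L) into the one for a e(S/L) = e(S/(L, f)); the
    lower bound is the same argument with all inequalities reversed.  When the
    resolution of S/L is shorter than s, both products for S/L vanish, the
    assumed bounds give e(S/L) = 0, and the new bounds read 0 <= 0 <= 0. *)

Set Implicit Arguments.
Unset Strict Implicit.
Unset Printing Implicit Defensive.

Import Order.TTheory GRing.Theory Num.Theory.

Local Open Scope ring_scope.

(** * Products of shifts *)

Section ShiftProducts.
Local Open Scope nat_scope.

(** Writing X_s, Y_s for the products of the first s factors, the induction
    proves Y_s (x_s + a) >= (s + 1) a X_s.  In the step, y_(s+1) x_(s+1) is
    bounded below using y_(s+1) >= x_s + a, which makes the induction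
    hypothesis apply, and y_(s+1) a using y_(s+1) >= x_(s+1) and Y_s >= X_s. *)
Lemma leq_prod_of_step (x y : nat -> nat) (a s : nat) :
    (forall i, i < s -> x i.+1 <= y i.+1) ->
    (forall i, i <= s -> x i + a <= y i.+1) ->
  s.+1 * a * \prod_(1 <= i < s.+1) x i <= \prod_(1 <= i < s.+2) y i.
Proof.
move=> le_xy le_xay; rewrite [leqRHS]big_nat_recr //=.
apply: leq_trans (leq_mul (leqnn _) (le_xay s (leqnn s))).
elim: s le_xy le_xay => [|s IHs] le_xy le_xay.
  by rewrite !big_geq // !mul1n muln1 leq_addl.
have le_prod : \prod_(1 <= i < s.+1) x i <= \prod_(1 <= i < s.+1) y i.
  rewrite !big_add1 !big_mkord; apply: leq_prod => i _; apply: le_xy.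
  exact: ltnW (ltn_ord i).
have {}IHs : s.+1 * a * \prod_(1 <= i < s.+1) x i
    <= (\prod_(1 <= i < s.+1) y i) * (x s + a).
  by apply: IHs => i lti; [apply: le_xy | apply: le_xay]; apply: ltnW.
have y1 := le_xy s (leqnn _); have y2 := le_xay s (leqnSn _).
rewrite !(big_nat_recr s.+1) //=; move: IHs le_prod y1 y2.
move: (x s) (x s.+1) (y s.+1) (\prod_(_ <= _ < _) _) (\prod_(_ <= _ < _) _).
move=> u v w Y X IH le_XY le_vw le_uw.
have -> : s.+2 * a * (X * v) = X * v * a + s.+1 * a * X * v by nia.
have -> : Y * w * (v + a) = Y * w * a + Y * w * v by lia.
apply: leq_add; first by rewrite !leq_mul.
by rewrite leq_mul // (leq_trans IH) // leq_mul.
Qed.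

(** The dual of [leq_prod_of_step]: the same induction with reversed
    inequalities.  Here the base case y_1 <= x_0 + a needs x_0 = 0. *)
Lemma geq_prod_of_step (x y : nat -> nat) (a s : nat) :
    x 0 = 0 ->
    (forall i, i < s -> y i.+1 <= x i.+1) ->
    (forall i, i <= s -> y i.+1 <= x i + a) ->
  \prod_(1 <= i < s.+2) y i <= s.+1 * a * \prod_(1 <= i < s.+1) x i.
Proof.
move=> x0 le_yx le_yxa; rewrite [leqLHS]big_nat_recr //=.
apply: leq_trans (leq_mul (leqnn _) (le_yxa s (leqnn s))) _.
elim: s le_yx le_yxa => [|s IHs] le_yx le_yxa.
  by rewrite !big_geq // x0 add0n !mul1n muln1.
have le_prod : \prod_(1 <= i < s.+1) y i <= \prod_(1 <= i < s.+1) x i.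
  rewrite !big_add1 !big_mkord; apply: leq_prod => i _; apply: le_yx.
  exact: ltnW (ltn_ord i).
have {}IHs : (\prod_(1 <= i < s.+1) y i) * (x s + a)
    <= s.+1 * a * \prod_(1 <= i < s.+1) x i.
  by apply: IHs => i lti; [apply: le_yx | apply: le_yxa]; apply: ltnW.
have y1 := le_yx s (leqnn _); have y2 := le_yxa s (leqnSn _).
rewrite !(big_nat_recr s.+1) //=; move: IHs le_prod y1 y2.
move: (x s) (x s.+1) (y s.+1) (\prod_(_ <= _ < _) _) (\prod_(_ <= _ < _) _).
move=> u v w X Y IH le_YX le_wv le_wu.
have -> : s.+2 * a * (X * v) = X * v * a + s.+1 * a * X * v by nia.
have -> : Y * w * (v + a) = Y * w * a + Y * w * v by lia.
apply: leq_add; first by rewrite !leq_mul.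
by rewrite leq_mul //; apply: leq_trans IH; rewrite leq_mul.
Qed.

Definition largest (l : seq nat) : nat := \max_(d <- l) d.

(** The default [head 0 l] keeps the value inside [l] when [l] is not empty, so
    that this is a genuine minimum. *)
Definition smallest (l : seq nat) : nat := \big[minn/head 0 l]_(d <- l) d.

Lemma leq_largest l d : d \in l -> d <= largest l.
Proof. by move=> ld; rewrite /largest; apply: leq_bigmax_seq. Qed.

Lemma largest_mem l : l != [::] -> largest l \in l.
Proof.
rewrite /largest; elim: l => // d [_ _|e l IHl _]; rewrite big_cons.
  by rewrite big_nil maxn0 mem_head.
rewrite inE /maxn; case: ifP => _; last by rewrite eqxx.
by rewrite IHl ?orbT.
Qed.

Lemma smallest_leq l d : d \in l -> smallest l <= d.
Proof.
rewrite /smallest; elim: l (head 0 l) => // e l IHl x.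
rewrite inE big_cons geq_min => /predU1P [->|/IHl ->]; rewrite ?leqnn //.
by rewrite orbT.
Qed.

Lemma smallest_mem l : l != [::] -> smallest l \in l.
Proof.
case: l => // d l _; rewrite /smallest /= big_cons.
suff /(_ l) : forall k, \big[minn/d]_(e <- k) e \in d :: k.
  by rewrite !inE /minn; case: ifP; rewrite ?eqxx // orbA orbb.
elim=> [|e k IHk]; rewrite ?big_nil ?mem_head // big_cons /minn.
case: ifP => _; first by rewrite !inE eqxx orbT.
by move: IHk; rewrite !inE => /orP [] ->; rewrite ?orbT.
Qed.

Lemma eq_mem_nil (l k : seq nat) : l =i k -> (l == [::]) = (k == [::]).
Proof.
case: l k => [|d l] [|e k] //= eqlk; first by have := eqlk e; rewrite mem_head.
by have := eqlk d; rewrite mem_head.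
Qed.

Lemma eq_largest l k : l =i k -> largest l = largest k.
Proof.
move=> eqlk; have [l0|l_neq0] := eqVneq l [::].
  have /eqP k0 : k == [::] by rewrite -(eq_mem_nil eqlk) l0.
  by rewrite l0 k0.
have k_neq0 : k != [::] by rewrite -(eq_mem_nil eqlk).
apply/eqP; rewrite eqn_leq !leq_largest //.
  by rewrite eqlk largest_mem.
by rewrite -eqlk largest_mem.
Qed.

Lemma eq_smallest l k : l =i k -> smallest l = smallest k.
Proof.
move=> eqlk; have [l0|l_neq0] := eqVneq l [::].
  have /eqP k0 : k == [::] by rewrite -(eq_mem_nil eqlk) l0.
  by rewrite l0 k0.
have k_neq0 : k != [::] by rewrite -(eq_mem_nil eqlk).
apply/eqP; rewrite eqn_leq !smallest_leq //.
  by rewrite -eqlk smallest_mem.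
by rewrite eqlk smallest_mem.
Qed.

End ShiftProducts.

(** The two inequalities of the theorem, for an arbitrary family of lists of
    shifts, so that they make sense for resolutions built by induction. *)
Definition within_shift_bounds (T : nat -> seq nat) (s : nat) (e : rat) :=
  (s`!%:R)^-1 * \prod_(1 <= i < s.+1) (smallest (T i))%:R <= e
    /\ e <= (s`!%:R)^-1 * \prod_(1 <= i < s.+1) (largest (T i))%:R.

Lemma eq_within_shift_bounds T T' s e : (forall i, T i =i T' i) ->
  within_shift_bounds T s e -> within_shift_bounds T' s e.
Proof.
move=> eqT [lo hi]; split.
  apply: le_trans lo; rewrite le_eqVlt; apply/orP; left; apply/eqP.
  by congr (_ * _); apply: eq_bigr => i _; rewrite (eq_smallest (eqT i)).
apply: (le_trans hi); rewrite le_eqVlt; apply/orP; left; apply/eqP.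
by congr (_ * _); apply: eq_bigr => i _; rewrite (eq_largest (eqT i)).
Qed.

(** One step of the induction on the numerical side: [T] and [T'] are the shifts
    of S/L and of S/(L, f), with deg f = a. *)
Lemma within_shift_bounds_cone (T T' : nat -> seq nat) (a s : nat) (e : rat) :
    T 0%N =i [:: 0%N] -> (forall i, T i = [::] -> T i.+1 = [::]) ->
    (forall i, T' i.+1 =i T i.+1 ++ [seq (a + d)%N | d <- T i]) ->
    within_shift_bounds T s e ->
  within_shift_bounds T' s.+1 (a%:R * e).
Proof.
move=> T0 Tnil T'E [lo hi].
have fact_gt0 k : 0 < (k`!%:R : rat) by rewrite ltr0n fact_gt0.
have T_nil i k : (i <= k)%N -> T i = [::] -> T k = [::].
  move/subnK <-; elim: (k - i)%N => // j IHj /IHj; exact: Tnil.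
have memT i d : d \in T i.+1 -> d \in T' i.+1.
  by rewrite T'E mem_cat => ->.
have memTa i d : d \in T i -> (d + a)%N \in T' i.+1.
  move=> Td; rewrite T'E mem_cat; apply/orP; right.
  by apply/mapP; exists d; rewrite // addnC.
have [Ts|Ts] := eqVneq (T s) [::].
  (* beyond the length of the resolution both products vanish *)
  have s_gt0 : (0 < s)%N by case: (s) Ts => // T00; have := T0 0%N; rewrite T00.
  have T's : T' s.+1 = [::].
    by apply/eqP; rewrite (@eq_mem_nil _ [::]) // => d; rewrite T'E Ts Tnil.
  rewrite /within_shift_bounds big_nat_recr //= T's /smallest big_nil mulr0 mulr0.
  rewrite big_nat_recr //= T's /largest big_nil mulr0 mulr0.
  move: lo hi; case: (s) s_gt0 Ts => // t _ Ts.
  rewrite !(big_nat_recr t.+1) //= Ts /smallest /largest !big_nil !mulr0.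
  move=> e1 e2; have /eqP -> : e == 0 by rewrite eq_le e1 e2.
  by rewrite mulr0.
have T_neq0 i : (i <= s)%N -> T i != [::].
  by move=> le_is; apply: contra Ts => /eqP Ti; rewrite (T_nil i).
have scale (p : rat) : (s.+1`!%:R)^-1 * (s.+1%:R * a%:R * p)
    = a%:R * ((s`!%:R)^-1 * p) :> rat.
  rewrite factS natrM invfM -!mulrA mulrCA mulKf ?pnatr_eq0 //.
  by rewrite mulrCA.
split.
  apply: le_trans (ler_wpM2l (ler0n _ a) lo); rewrite -scale.
  rewrite ler_pM2l ?invr_gt0 // -!natr_prod -!natrM ler_nat.
  apply: geq_prod_of_step => [|i lt_is|i le_is].
  - by rewrite (eq_smallest T0) /smallest big_cons big_nil.
  - exact/smallest_leq/memT/smallest_mem/T_neq0.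
  - exact/smallest_leq/memTa/smallest_mem/T_neq0.
apply: le_trans (ler_wpM2l (ler0n _ a) hi) _; rewrite -scale.
rewrite ler_pM2l ?invr_gt0 // -!natr_prod -!natrM ler_nat.
apply: leq_prod_of_step => [i lt_is|i le_is].
- exact/leq_largest/memT/largest_mem/T_neq0.
- exact/leq_largest/memTa/largest_mem/T_neq0.
Qed.

(** * Ideals and homogeneous components *)

Section Ideals.
Variables (K : fieldType) (n : nat).
Local Notation S := {mpoly K[n]}.
Implicit Types (I : {pred S}) (f g h : S).

Lemma mem_adjoin1 I f g :
  (g \in adjoin I [:: f]) <-> exists2 a, a \in I & exists h, g = a + h * f.
Proof.
split=> [/asboolP [a Ia [h ->]]|[a Ia [h ->]]].
  by exists a => //; exists (h 0%N); rewrite big_ord1.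
by apply/asboolP; exists a => //; exists (fun=> h); rewrite big_ord1.
Qed.

Lemma adjoin_nil I : adjoin I [::] = I.
Proof.
apply: funext => g; apply/asboolP/idP => [[a Ia [h ->]]|Ig].
  by rewrite big_ord0 addr0.
by exists g => //; exists (fun=> 0); rewrite big_ord0 addr0.
Qed.

(** Adjoining the elements one after the other allows induction on the regular
    sequence, with the ideal varying. *)
Lemma adjoin_cons I f (fs : seq S) :
  adjoin I (f :: fs) = adjoin (adjoin I [:: f]) fs.
Proof.
apply: funext => g; apply/asboolP/asboolP => [[a Ia [h ->]]|].
  exists (a + h 0%N * f); first by apply/mem_adjoin1; exists a => //; exists (h 0%N).
  by exists (fun i => h i.+1); rewrite /= big_ord_recl addrA.
move=> [_ /mem_adjoin1 [a Ia [h0 ->]] [h ->]]; exists a => //.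
exists (fun i => if i is j.+1 then h j else h0).
by rewrite /= big_ord_recl addrA.
Qed.

Section Closure.
Variable I : {pred S}.
Hypothesis idealI : idealr_closed I.

Lemma ideal0 : 0 \in I.
Proof. by case: idealI. Qed.

Lemma ideal1 : 1 \notin I.
Proof. by case: idealI. Qed.

Lemma idealMl g f : f \in I -> g * f \in I.
Proof. by case: idealI => I0 _ closI If; rewrite -[_ * _]addr0 closI. Qed.

Lemma idealD f g : f \in I -> g \in I -> f + g \in I.
Proof. by case: idealI => _ _ closI If Ig; rewrite -[f]mul1r closI. Qed.

Lemma idealB f g : f \in I -> g \in I -> f - g \in I.
Proof. by move=> If Ig; rewrite idealD // -mulN1r idealMl. Qed.

Lemma idealZ (c : K) f : f \in I -> c *: f \in I.
Proof. by rewrite -mul_mpolyC; apply: idealMl. Qed.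

Lemma ideal_sum (T : Type) (r : seq T) (F : T -> S) :
  (forall i, F i \in I) -> \sum_(i <- r) F i \in I.
Proof.
move=> IF; elim: r => [|i r IHr]; rewrite ?big_nil ?ideal0 // big_cons.
exact: idealD.
Qed.

End Closure.

(** Multiplication by a homogeneous element shifts homogeneous components. *)
Lemma pihomogMr d c g f : f \is c.-homog ->
  pihomog mdeg d (g * f)
    = if (c <= d)%N then pihomog mdeg (d - c) g * f else 0.
Proof.
move=> fc; have -> : pihomog mdeg d (g * f)
    = \sum_(u <- msupp g) g@_u *: (if (mdeg u + c == d)%N then 'X_[u] * f else 0).
  rewrite {1}[g]mpolyE mulr_suml raddf_sum /=; apply: eq_bigr => u _.
  rewrite -scalerAl linearZ /=; congr (_ *: _).
  have Xuf : 'X_[u] * f \is (mdeg u + c).-homog by rewrite dhomogM // dhomogX.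
  case: eqP => [<-|/eqP ne]; first exact: pihomog_dE.
  exact: pihomog_ne0 ne Xuf.
case: leqP => [le_cd|lt_dc]; last first.
  rewrite big1 // => u _; case: eqP => [e|]; rewrite ?scaler0 //; lia.
rewrite pihomogE mulr_suml [RHS]big_mkcond /=; apply: eq_bigr => u _.
have -> : (mdeg u + c == d)%N = (mdeg u == d - c)%N by lia.
by case: eqP; rewrite ?scaler0 // scalerAl.
Qed.

Lemma adjoin_graded_ideal I f c : graded_ideal I -> f \is c.-homog ->
  1 \notin adjoin I [:: f] -> graded_ideal (adjoin I [:: f]).
Proof.
move=> [idealI gradI] fc one; split=> [|d g]; first split=> //.
- by apply/mem_adjoin1; exists 0; rewrite ?ideal0 //; exists 0; rewrite mul0r addr0.
- move=> r _ _ /mem_adjoin1 [a Ia [g ->]] /mem_adjoin1 [b Ib [h ->]].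
  apply/mem_adjoin1; exists (r * a + b); first by rewrite idealD ?idealMl.
  by exists (r * g + h); ring.
move=> /mem_adjoin1 [a Ia [h ->]]; apply/mem_adjoin1.
exists (pihomog mdeg d a); first exact: gradI.
rewrite raddfD /= (pihomogMr _ _ fc).
case: ifP => _; last by exists 0; rewrite mul0r.
by exists (pihomog mdeg (d - c) h).
Qed.

End Ideals.

(** * Hilbert functions *)

Section HilbertFunction.
Variables (K : fieldType) (n : nat).
Local Notation S := {mpoly K[n]}.
Implicit Types (I : {pred S}) (f g : S) (h : nat).

Definition combination h (c : 'rV[K]_h) (b : 'I_h -> S) : S :=
  \sum_(i < h) c 0 i *: b i.

Lemma combinationB h (c d : 'rV[K]_h) b :
  combination (c - d) b = combination c b - combination d b.
Proof.
by rewrite -sumrB; apply: eq_bigr => i _; rewrite !mxE scalerBl.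
Qed.

Lemma combination_mulmx h k (c : 'rV[K]_h) (A : 'M[K]_(h, k)) b :
  combination (c *m A) b = combination c (fun i => combination (row i A) b).
Proof.
rewrite /combination; under eq_bigr do rewrite mxE scaler_suml.
rewrite exchange_big; apply: eq_bigr => i _; rewrite scaler_sumr.
by apply: eq_bigr => j _; rewrite scalerA mxE.
Qed.

Lemma combination_homog d h (c : 'rV[K]_h) b :
  (forall i, b i \is d.-homog) -> combination c b \is d.-homog.
Proof. by move=> bd; apply: rpred_sum => i _; apply: dhomogZ. Qed.

Lemma combination_congr I h (c : 'rV[K]_h) b b' : idealr_closed I ->
  (forall i, b i - b' i \in I) -> combination c b - combination c b' \in I.
Proof.
move=> idealI Ib; rewrite -sumrB; apply: ideal_sum => // i.
by rewrite -scalerBr; apply: idealZ.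
Qed.

Lemma quot_dimP I k h : quot_dim I k h <->
  exists b : 'I_h -> S,
    [/\ forall i, b i \is k.-homog,
        forall c, combination c b \in I -> c = 0
      & forall g, g \is k.-homog -> exists c, g - combination c b \in I].
Proof.
have combE (c : 'I_h -> K) b :
    \sum_(i < h) c i *: b i = combination (\row_i c i) b.
  by apply: eq_bigr => i _; rewrite mxE.
split=> -[b [bk free span]]; exists b; split=> //.
- move=> c Icb; apply/rowP => i; rewrite mxE; exact: (free (c 0)).
- by move=> g /span [c Igc]; exists (\row_i c i); rewrite -combE.
- by move=> c; rewrite combE => /free /rowP ci i; have := ci i; rewrite !mxE.
- by move=> g /span [c Igc]; exists (c 0).
Qed.

(** Expressing the family b in b' modulo I is the matrix A, up to I, which turns
    questions on dimensions of (S/I)_k into questions on ranks. *)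
Lemma combination_matrix I h h' (b : 'I_h -> S) (b' : 'I_h' -> S) :
    idealr_closed I -> (forall i, exists c, b i - combination c b' \in I) ->
  exists A : 'M[K]_(h, h'),
    forall c, combination c b - combination (c *m A) b' \in I.
Proof.
move=> idealI /fin_all_exists [A bA]; exists (\matrix_i A i) => c.
rewrite combination_mulmx; apply: combination_congr => // i.
by rewrite rowK.
Qed.

Lemma quot_dim_le I k h h' : idealr_closed I ->
  quot_dim I k h -> quot_dim I k h' -> (h <= h')%N.
Proof.
move=> idealI /quot_dimP [b [bk free _]] /quot_dimP [b' [_ _ span]].
have [i|A bA] := combination_matrix (b := b) (b' := b') idealI.
  exact: span.
suff : row_free A by rewrite -row_leq_rank => /leq_trans; apply; apply: rank_leq_col.
apply: inj_row_free => c cA0; apply: free; have := bA c.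
by rewrite cA0 /combination [X in _ - X]big1 ?subr0 // => i _; rewrite mxE scale0r.
Qed.

Lemma quot_dim_uniq I k h h' : idealr_closed I ->
  quot_dim I k h -> quot_dim I k h' -> h = h'.
Proof.
move=> idealI Ih Ih'; apply/eqP.
by rewrite eqn_leq (quot_dim_le idealI Ih Ih') (quot_dim_le idealI Ih' Ih).
Qed.

(** If J_k is I_k plus the span of a family b0 that is independent modulo I, then
    (S/J)_k is the quotient of (S/I)_k by an h0-dimensional subspace.  In
    coordinates that subspace is the row space of A, and a basis of a complement
    of it gives a basis of (S/J)_k. *)
Lemma quot_dim_complement I J k h h0 (b0 : 'I_h0 -> S) :
    idealr_closed I -> quot_dim I k h ->
    (forall i, b0 i \is k.-homog) ->
    (forall c, combination c b0 \in I -> c = 0) ->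
    (forall g, g \is k.-homog ->
       (g \in J <-> exists c, g - combination c b0 \in I)) ->
  quot_dim J k (h - h0) /\ (h0 <= h)%N.
Proof.
move=> idealI /quot_dimP [b [bk free span]] b0k free0 memJ.
have [i|A b0A] := combination_matrix (b := b0) (b' := b) idealI.
  exact: span.
have freeA : row_free A.
  apply: inj_row_free => c cA0; apply: free0; have := b0A c.
  by rewrite cA0 /combination [X in _ - X]big1 ?subr0 // => i _; rewrite mxE scale0r.
have rankA : \rank A = h0 by apply/eqP.
split; last by rewrite -rankA rank_leq_col.
rewrite -rankA -mxrank_compl; set B := row_base A^C%MS.
apply/quot_dimP; exists (fun i => combination (row i B) b); split.
- by move=> i; apply: combination_homog.
- move=> c; rewrite -combination_mulmx memJ; last exact: combination_homog.
  move=> [d Id]; have /free /eqP : combination (c *m B - d *m A) b \in I.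
    rewrite combinationB; have := idealD idealI Id (b0A d).
    by rewrite addrA subrK.
  rewrite subr_eq0 => /eqP cBdA.
  have : (c *m B <= A :&: A^C)%MS.
    rewrite sub_capmx {1}cBdA submxMl /=.
    by rewrite (submx_trans (submxMl _ _)) // eq_row_base.
  rewrite capmx_compl submx0 mulmx_free_eq0 ?row_base_free // => /eqP.
  exact.
move=> g gk; have [x Igx] := span g gk.
have : (x <= A + B)%MS.
  rewrite (submx_trans (submx1 x)) //.
  have := addsmx_compl_full A; rewrite -sub1mx => /submx_trans; apply.
  by rewrite addsmxS // eq_row_base.
case/sub_addsmxP => -[u w] /= xE; exists w.
rewrite -combination_mulmx memJ; last first.
  by apply: rpredB => //; apply: combination_homog.
exists u; have := idealB idealI Igx (b0A u).
have -> : combination x b = combination (u *m A) b + combination (w *m B) b.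
  by rewrite xE /combination -big_split; apply: eq_bigr => i _; rewrite mxE scalerDl.
set p := (p in p \in I -> _); set q := (q in _ -> q \in I).
by have -> : q = p by rewrite /p /q; ring.
Qed.

Section HyperplaneSection.
Variables (I : {pred S}) (f : S) (d : nat).
Hypothesis gradedI : graded_ideal I.
Hypothesis homog_f : f \is d.-homog.
Hypothesis regular_f : forall g, f * g \in I -> g \in I.

Let idealI : idealr_closed I. Proof. by case: gradedI. Qed.

(** Membership of a homogeneous element in (I, f) can be witnessed by a
    homogeneous multiple of f of the same degree, because I is graded. *)
Lemma mem_adjoin_homog k g : g \is k.-homog -> g \in adjoin I [:: f] <->
  exists q, g - (if (d <= k)%N then pihomog mdeg (k - d) q * f else 0) \in I.
Proof.
move=> gk; split=> [/mem_adjoin1 [b Ib [q gE]]|[q Igq]].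
  exists q; rewrite -(pihomogMr _ _ homog_f) -[g](pihomog_dE gk) -raddfB /=.
  by apply: (proj2 gradedI); rewrite gE addrK.
apply/mem_adjoin1.
exists (g - (if (d <= k)%N then pihomog mdeg (k - d) q * f else 0)) => //.
case: ifP => _; first by exists (pihomog mdeg (k - d) q); rewrite subrK.
by exists 0; rewrite mul0r subr0 addr0.
Qed.

(** The exact sequence 0 -> (S/I)_(k-d) -> (S/I)_k -> (S/(I,f))_k -> 0, whose first
    map, multiplication by f, is injective by regularity. *)
Lemma quot_dim_adjoin k h h0 : (d <= k)%N ->
    quot_dim I k h -> quot_dim I (k - d) h0 ->
  quot_dim (adjoin I [:: f]) k (h - h0) /\ (h0 <= h)%N.
Proof.
move=> le_dk Ih /quot_dimP [b [bk free span]].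
have combE c : combination c (fun i => b i * f) = combination c b * f.
  by rewrite mulr_suml; apply: eq_bigr => i _; rewrite scalerAl.
apply: (quot_dim_complement (b0 := fun i => b i * f) idealI Ih).
- by move=> i; rewrite -(subnK le_dk) dhomogM.
- by move=> c; rewrite combE mulrC => /regular_f /free.
move=> g gk; rewrite (mem_adjoin_homog gk) le_dk; split=> [[q Iq]|[c Ic]].
  have [c Iqc] := span _ (pihomogP mdeg (k - d) q); exists c.
  have := idealD idealI Iq (idealMl idealI f Iqc).
  rewrite combE; set p := (p in p \in I -> _).
  by set r := (r in _ -> r \in I); have -> : r = p by rewrite /p /r; ring.
exists (combination c b); rewrite pihomog_dE; first by rewrite -combE.
exact: combination_homog.
Qed.

Lemma quot_dim_adjoin_low k h : (k < d)%N ->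
  quot_dim I k h -> quot_dim (adjoin I [:: f]) k h.
Proof.
move=> lt_kd Ih; rewrite -[h]subn0.
have [] := @quot_dim_complement I (adjoin I [:: f]) k h 0 (fun=> 0) idealI Ih.
- by case.
- by move=> c _; apply/rowP; case.
- move=> g gk; rewrite (mem_adjoin_homog gk) leqNgt lt_kd /=.
  have comb0 (c : 'rV[K]_0) : combination c (fun=> 0) = 0.
    by rewrite /combination big_ord0.
  by split=> -[c]; rewrite ?comb0 => Ig; exists 0; rewrite ?comb0.
- by [].
Qed.

End HyperplaneSection.
End HilbertFunction.

(** * Hilbert polynomials and multiplicity *)

Section BackwardDifference.
Variable a : rat.
Local Notation q := ('X - a%:P).

(** Both facts follow from
    X^(j+1) - (X - a)^(j+1) = a X^j + (X^j - (X - a)^j) (X - a). *)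
Lemma backward_difference_Xn i :
  (size ('X^i - q ^+ i)%R <= i)%N /\ ('X^(i.+1) - q ^+ i.+1)`_i = i.+1%:R * a.
Proof.
have step j : 'X^(j.+1) - q ^+ j.+1 = a *: 'X^j + ('X^j - q ^+ j) * q.
  by rewrite -mul_polyC !exprSr; ring.
have size_diff j : (size ('X^j - q ^+ j)%R <= j)%N.
  elim: j => [|j IHj]; first by rewrite subrr size_poly0.
  rewrite step (leq_trans (size_polyD _ _)) // geq_max.
  rewrite (leq_trans (size_scale_leq _ _)) ?size_polyXn //=.
  by rewrite (leq_trans (size_polyMleq _ _)) // size_XsubC addn2.
split=> //; elim: i => [|i IHi].
  by rewrite !expr1 opprB addrC subrK coefC eqxx mul1r.
rewrite step coefD coefZ coefXn eqxx mulr1 mulrBr coefB coefMX /= IHi.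
by rewrite coefMC nth_default ?size_diff // mul0r subr0 [in RHS]mulrSr; ring.
Qed.

Lemma backward_difference (P : {poly rat}) m : (size P <= m.+2)%N ->
  (size (P - (P \Po q))%R <= m.+1)%N
    /\ (P - (P \Po q))`_m = m.+1%:R * a * P`_m.+1.
Proof.
move=> sizeP; have -> : P - (P \Po q)
    = \sum_(i < m.+2) P`_i *: ('X^i - q ^+ i).
  have PE : P = \sum_(i < m.+2) P`_i *: 'X^i.
    rewrite -poly_def; apply/polyP => i; rewrite coef_poly.
    by case: ltnP => // le_mi; rewrite nth_default // (leq_trans sizeP).
  have -> : P \Po q = \sum_(i < m.+2) P`_i *: q ^+ i.
    rewrite [in LHS]PE linear_sum; apply: eq_bigr => i _ /=.
    by rewrite comp_polyZ comp_Xn_poly.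
  by rewrite [in X in X - _]PE -sumrB; apply: eq_bigr => i _; rewrite scalerBr.
have size_term i : (size (P`_i *: ('X^i - q ^+ i))%R <= i)%N.
  by rewrite (leq_trans (size_scale_leq _ _)) // (proj1 (backward_difference_Xn i)).
split.
  apply: (leq_trans (size_sum _ _ _)); apply/bigmax_leqP => i _.
  by rewrite (leq_trans (size_term i)) // -ltnS.
rewrite big_ord_recr coefD coef_sum big1 => [|i _]; last first.
  by rewrite nth_default // (leq_trans (size_term i)) // -ltnS.
by rewrite add0r coefZ (proj2 (backward_difference_Xn m)) mulrC.
Qed.

End BackwardDifference.

Lemma poly_eq_eventually (P Q : {poly rat}) k0 :
  (forall k, (k0 <= k)%N -> P.[k%:R] = Q.[k%:R]) -> P = Q.
Proof.
move=> eqPQ; apply/eqP; rewrite -subr_eq0; apply: contraT => PQ_neq0.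
pose rs : seq rat := [seq k%:R | k <- iota k0 (size (P - Q))].
have : (size rs < size (P - Q)%R)%N.
  apply: max_poly_roots => //; last first.
    by rewrite map_inj_uniq ?iota_uniq // => i j /eqP; rewrite eqr_nat => /eqP.
  apply/allP => _ /mapP [k + ->]; rewrite mem_iota => /andP [le_k _].
  by rewrite rootE hornerD hornerN eqPQ // subrr.
by rewrite size_map size_iota ltnn.
Qed.

Section Multiplicity.
Variables (K : fieldType) (n : nat).
Local Notation S := {mpoly K[n]}.
Implicit Types (I : {pred S}) (f g : S).

Lemma sum_eventually0 (H : nat -> nat) k0 k1 :
    (forall k, (k0 <= k)%N -> H k = 0%N) -> (k0 <= k1)%N ->
  (\sum_(k < k1) H k = \sum_(k < k0) H k)%N.
Proof.
move=> H0 le_k; rewrite -!(big_mkord xpredT) (big_cat_nat (n := k0)) //=.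
rewrite [X in (_ + X)%N]big_nat_cond [X in (_ + X)%N]big1 ?addn0 // => k.
by case/andP => /andP [/H0].
Qed.

Lemma multiplicity_uniq I e e' : idealr_closed I ->
  multiplicity I e -> multiplicity I e' -> e = e'.
Proof.
move=> idealI [H [P [k0 [HI HP ->]]]] [H' [P' [k0' [HI' HP' ->]]]].
have eqH k : H' k = H k := quot_dim_uniq idealI (HI' k) (HI k).
have PE : P' = P.
  apply: (@poly_eq_eventually _ _ (maxn k0 k0')) => k.
  by rewrite geq_max => /andP [/HP <- /HP' <-]; rewrite eqH.
rewrite PE in HP' *; case: ifP => // /eqP P0; congr _%:R.
have H0 k : (k0 <= k)%N -> H k = 0%N.
  by move/HP/eqP; rewrite P0 horner0 pnatr_eq0 => /eqP.
have H0' k : (k0' <= k)%N -> H k = 0%N.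
  by move/HP'/eqP; rewrite eqH P0 horner0 pnatr_eq0 => /eqP.
under [RHS]eq_bigr do rewrite eqH.
by rewrite -(sum_eventually0 H0 (leq_maxl k0 k0')) (sum_eventually0 H0' (leq_maxr _ _)).
Qed.

(** The telescoping behind the finite length case: here [H'] is the difference
    of H and its translate by d, with H(k) = 0 for k < 0. *)
Lemma sum_backward_difference (H H' : nat -> nat) (d k0 : nat) :
    (forall k, (k < d)%N -> H' k = H k) ->
    (forall k, (d <= k)%N -> (H' k + H (k - d))%N = H k) ->
  (\sum_(k < k0 + d) H' k = \sum_(i < d) H (k0 + i))%N.
Proof.
move=> H'low H'high; apply: (@addIn (\sum_(i < k0) H i)%N).
transitivity (\sum_(k < k0 + d) H k)%N; last by rewrite big_split_ord /= addnC.
rewrite addnC [in LHS]addnC (addnC k0 d) !big_split_ord /= -addnA -big_split /=.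
congr (_ + _)%N; apply: eq_bigr => i _; first by rewrite H'low.
by rewrite -[in RHS]H'high ?leq_addr // addKn.
Qed.

(** Three cases, by the Hilbert polynomial P of S/I.  If deg P > 0, then
    P(X) - P(X - d) has degree deg P - 1 and leading coefficient
    d deg P lead(P).  If P is a nonzero constant c, then S/(I, f) has
    finite length, and telescoping gives length d c.  If P = 0, then
    H(k) <= H(k + d) forces H = 0, so both multiplicities vanish. *)
Lemma multiplicity_adjoin I f d e : graded_ideal I -> f \is d.-homog ->
    (0 < d)%N -> (forall g, f * g \in I -> g \in I) ->
  multiplicity I e -> multiplicity (adjoin I [:: f]) (d%:R * e).
Proof.
move=> gradedI fd d_gt0 regf [H [P [k0 [HI HP ->]]]].
pose H' k := if (d <= k)%N then (H k - H (k - d))%N else H k.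
have le_H k : (d <= k)%N -> (H (k - d) <= H k)%N.
  by move=> le_dk; have [] := quot_dim_adjoin gradedI fd regf le_dk (HI k) (HI _).
have H'high k : (d <= k)%N -> (H' k + H (k - d))%N = H k.
  by move=> le_dk; rewrite /H' le_dk subnK ?le_H.
have H'low k : (k < d)%N -> H' k = H k by rewrite /H' ltnNge; case: (d <= k)%N.
have H'I : hilbert_function (adjoin I [:: f]) H'.
  move=> k; rewrite /H'; case: leqP => [le_dk|lt_kd].
    by have [] := quot_dim_adjoin gradedI fd regf le_dk (HI k) (HI _).
  exact: (quot_dim_adjoin_low gradedI fd lt_kd (HI k)).
pose Q := P - (P \Po ('X - d%:R%:P)).
have H'Q k : (k0 + d <= k)%N -> (H' k)%:R = Q.[k%:R].
  move=> le_k; have le_dk : (d <= k)%N by apply: leq_trans le_k; apply: leq_addl.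
  have le_k0 : (k0 <= k - d)%N by rewrite leq_subRL // addnC.
  rewrite /H' le_dk natrB ?le_H // (HP _ (leq_trans (leq_addr _ _) le_k)) (HP _ le_k0).
  by rewrite hornerD hornerN horner_comp !hornerE natrB.
exists H', Q, (k0 + d)%N; split=> //.
case sizeP: (size P) => [|[|m]].
- have P0 : P = 0 by apply/eqP; rewrite -size_poly_eq0 sizeP.
  have H0 k : (k0 <= k)%N -> H k = 0%N.
    by move/HP/eqP; rewrite P0 horner0 pnatr_eq0 => /eqP.
  have le_H_iter k j : (H k <= H (k + j * d))%N.
    elim: j => [|j IHj]; first by rewrite mul0n addn0.
    apply: (leq_trans IHj); rewrite mulSn addnCA.
    by have := le_H (d + (k + j * d))%N (leq_addr _ _); rewrite addKn.
  rewrite /Q P0 comp_poly0 subrr eqxx (sum_backward_difference _ H'low H'high).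
  rewrite !big1 ?mulr0 // => i _; first by rewrite H0 ?leq_addr.
  apply/eqP; rewrite -leqn0 -(H0 (i + k0 * d)%N) ?le_H_iter //.
  by rewrite (leq_trans _ (leq_addl _ _)) // leq_pmulr.
- have /size_poly1P [c c_neq0 PE] : size P == 1%N by rewrite sizeP.
  rewrite /Q PE comp_polyC subrr eqxx polyC_eq0 (negPf c_neq0).
  rewrite fact0 mul1r lead_coefC (sum_backward_difference _ H'low H'high) natr_sum.
  under eq_bigr do rewrite HP ?leq_addr // PE hornerC.
  by rewrite sumr_const card_ord mulr_natl.
have [sizeQ coefQ] := @backward_difference d%:R P m (eq_leq sizeP).
have lcP : lead_coef P = P`_m.+1 by rewrite lead_coefE sizeP.
have P_neq0 : P != 0 by rewrite -size_poly_eq0 sizeP.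
have Qm_neq0 : Q`_m != 0.
  by rewrite coefQ !mulf_neq0 ?pnatr_eq0 -?lt0n // -lcP lead_coef_eq0.
have sizeQE : size Q = m.+1.
  apply/eqP; rewrite eqn_leq sizeQ ltnNge; apply: contra Qm_neq0 => le_Q.
  by rewrite nth_default.
have lcQ : lead_coef Q = Q`_m by rewrite lead_coefE sizeQE.
rewrite -[Q == 0]size_poly_eq0 sizeQE (negPf P_neq0) /= lcQ coefQ lcP.
by rewrite factS natrM; ring.
Qed.
End Multiplicity.

(** * Minimal free resolutions *)

Section GradedMatrices.
Variables (K : fieldType) (n : nat).
Local Notation S := {mpoly K[n]}.

(** [A] maps the generator of degree [x 0 j] to an element of the same degree in
    the free module with generators of degrees [y 0 k]. *)
Definition degree_preserving p q (x : 'rV[nat]_p) (y : 'rV[nat]_q)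
    (A : 'M[S]_(p, q)) :=
  forall j k (u : 'X_{1..n}), u \in msupp (A j k) ->
    (mdeg u + y 0%R k)%N = x 0%R j.

(** The homogeneous component of degree 0 of a map between graded free modules;
    it replaces an arbitrary lift by a homogeneous one. *)
Definition degree0_part p q (x : 'rV[nat]_p) (y : 'rV[nat]_q)
    (A : 'M[S]_(p, q)) : 'M[S]_(p, q) :=
  \matrix_(j, k) if (y 0%R k <= x 0%R j)%N
                 then pihomog mdeg (x 0%R j - y 0%R k) (A j k) else 0.

Definition constant_terms p q (A : 'M[S]_(p, q)) : 'M[K]_(p, q) :=
  map_mx (mcoeff 0%MM) A.

Lemma degree_preservingP p q x y (A : 'M[S]_(p, q)) :
  degree_preserving x y A <->
  forall j k, A j k = 0 \/ (y 0%R k <= x 0%R j)%N /\ A j k \is (x 0%R j - y 0%R k).-homog.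
Proof.
split=> [Axy j k|Axy j k u].
  have [->|A_neq0] := eqVneq (A j k) 0; [by left | right].
  have le_yx : (y 0%R k <= x 0%R j)%N.
    by rewrite -(Axy j k _ (mlead_supp A_neq0)) leq_addl.
  split=> //; apply/dhomogP => u /Axy <-; by rewrite addnK.
case: (Axy j k) => [->|[le_yx /dhomogP hom] /hom ->]; first by rewrite msupp0.
by rewrite subnK.
Qed.

Lemma degree_preserving_mul p q r x y z (A : 'M[S]_(p, q)) (B : 'M[S]_(q, r)) :
  degree_preserving x y A -> degree_preserving y z B ->
  degree_preserving x z (A *m B).
Proof.
move=> /degree_preservingP Axy /degree_preservingP Byz j l u; rewrite mxE.
move/msupp_sum_le/flattenP => [_ /mapP [k _ ->]].
case: (Axy j k) => [->|[le_yx Ahom]]; first by rewrite mul0r msupp0.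
case: (Byz k l) => [->|[le_zy Bhom]]; first by rewrite mulr0 msupp0.
by move/(dhomog_mf (dhomogM Ahom Bhom)) => /= ->; lia.
Qed.

Lemma degree0_part_preserving p q x y (A : 'M[S]_(p, q)) :
  degree_preserving x y (degree0_part x y A).
Proof.
apply/degree_preservingP => j k; rewrite mxE; case: leqP => _; last by left.
by right; split=> //; apply: pihomogP.
Qed.

Lemma degree0_part_id p q x y (A : 'M[S]_(p, q)) :
  degree_preserving x y A -> degree0_part x y A = A.
Proof.
move=> /degree_preservingP Axy; apply/matrixP => j k; rewrite mxE.
case: (Axy j k) => [->|[-> /pihomog_dE //]].
by rewrite pihomog0; case: ifP.
Qed.

(** Composition with a map of degree 0 commutes with taking components. *)
Lemma degree0_part_mul p q r x y z (A : 'M[S]_(p, q)) (B : 'M[S]_(q, r)) :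
  degree_preserving y z B ->
  degree0_part x z (A *m B) = degree0_part x y A *m B.
Proof.
move=> /degree_preservingP Byz; apply/matrixP => j l; rewrite !mxE.
transitivity (\sum_k (if (z 0%R l <= x 0%R j)%N
    then pihomog mdeg (x 0%R j - z 0%R l) (A j k * B k l) else 0)).
  by case: ifP => _; [rewrite raddf_sum | rewrite big1].
apply: eq_bigr => k _; rewrite mxE; case: (Byz k l) => [->|[le_zy Bhom]].
  by rewrite !mulr0 pihomog0 if_same.
rewrite (pihomogMr _ _ Bhom).
case: (leqP (z 0%R l) (x 0%R j)) => [le_zx|lt_xz]; last first.
  by rewrite leqNgt (leq_trans lt_xz) // mul0r.
have -> : (y 0%R k - z 0%R l <= x 0%R j - z 0%R l)%N = (y 0%R k <= x 0%R j)%N by lia.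
case: ifP => [le_yx|_]; last by rewrite mul0r.
by have -> : (x 0%R j - z 0%R l - (y 0%R k - z 0%R l) = x 0%R j - y 0%R k)%N by lia.
Qed.

Lemma constant_termsM p q r (A : 'M[S]_(p, q)) (B : 'M[S]_(q, r)) :
  constant_terms (A *m B) = constant_terms A *m constant_terms B.
Proof. exact: map_mxM. Qed.

Lemma constant_terms1 p : constant_terms (1%:M : 'M[S]_p) = 1%:M.
Proof. exact: map_mx1. Qed.

Lemma homog_constant_term d (g : S) :
  (0 < d)%N -> g \is d.-homog -> g@_0%MM = 0.
Proof.
move=> d_gt0 gd; apply: (dhomog_nemf_coeff gd).
by rewrite /= mdeg0 eq_sym -lt0n.
Qed.

Lemma irrelevant_constant_term (g : S) : g \in irrelevant K n -> g@_0%MM = 0.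
Proof.
move/asboolP => [a /eqP -> [h ->]]; rewrite add0r raddf_sum big1 // => j _ /=.
have [i ->] : exists i : 'I_n, [seq 'X_i | i : 'I_n]`_j = ('X_i : S).
  by have /mapP [i _ ->] := mem_nth 0 (ltn_ord j); exists i.
rewrite rmorphM /= [X in _ * X](homog_constant_term (d := 1)) ?mulr0 //.
by rewrite dhomogX /= mdeg1.
Qed.

End GradedMatrices.

Section Resolutions.
Variables (K : fieldType) (n : nat).
Local Notation S := {mpoly K[n]}.
Implicit Types (L : {pred S}).

(** Maps act on row vectors from the right, so [diff C i] goes from the module in
    homological degree i + 1 to the one in degree i. *)
Record graded_complex := GradedComplex {
  rk : nat -> nat;
  degs : forall i, 'rV[nat]_(rk i);
  diff : forall i, 'M[S]_(rk i.+1, rk i) }.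

Definition shift_seq C i : seq nat := [seq degs C i 0 j | j : 'I_(rk C i)].

(** The augmentation is stated for all vectors v in the module of degree 0, by
    the condition that the entries of v lie in L.  As that module has rank 1
    this says that the image of the first map is L, and it avoids casts
    between that rank and 1.  Minimality says that the entries of the maps have
    no constant term. *)
Record minimally_resolves L (C : graded_complex) : Prop := MinimallyResolves {
  rk0 : rk C 0 = 1%N;
  degs0 : forall k, degs C 0 0 k = 0%N;
  diff_preserving : forall i, degree_preserving (degs C i.+1) (degs C i) (diff C i);
  diff_minimal : forall i, constant_terms (diff C i) = 0;
  augmentation : forall v : 'rV_(rk C 0),
    (exists w, v = w *m diff C 0) <-> forall k, v 0 k \in L;
  exactness : forall i (v : 'rV_(rk C i.+1)),
    v *m diff C i = 0 <-> exists w, v = w *m diff C i.+1 }.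

Lemma mem_shift_seq C i d :
  reflect (exists j, d = degs C i 0 j) (d \in shift_seq C i).
Proof. by apply: (iffP mapP) => [[j _ ->]|[j ->]]; exists j; rewrite ?mem_enum. Qed.

Lemma shift_seq_nil C i : (shift_seq C i == [::]) = (rk C i == 0%N).
Proof. by rewrite -size_eq0 size_map -cardE card_ord. Qed.

Section OneResolution.
Variables (L : {pred S}) (C : graded_complex).
Hypothesis resC : minimally_resolves L C.

Lemma shift_seq0 : shift_seq C 0 =i [:: 0%N].
Proof.
move=> d; rewrite inE; apply/mem_shift_seq/eqP => [[j ->]|->].
  exact: degs0 resC j.
have lt0 : (0 < rk C 0)%N by rewrite (rk0 resC).
by exists (Ordinal lt0); rewrite (degs0 resC).
Qed.

Lemma lift_rows i p (V : 'M_(p, rk C i.+1)) : V *m diff C i = 0 ->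
  exists W, V = W *m diff C i.+1.
Proof.
move=> V0; have /fin_all_exists [W WE] : forall j, exists w, row j V = w *m diff C i.+1.
  by move=> j; apply/(exactness resC); rewrite -row_mul V0 row0.
by exists (\matrix_j W j); apply/row_matrixP => j; rewrite row_mul rowK.
Qed.

Lemma lift_rows0 p (V : 'M_(p, rk C 0)) : (forall j k, V j k \in L) ->
  exists W, V = W *m diff C 0.
Proof.
move=> VL; have /fin_all_exists [W WE] : forall j, exists w, row j V = w *m diff C 0.
  by move=> j; apply/(augmentation resC) => k; rewrite mxE.
by exists (\matrix_j W j); apply/row_matrixP => j; rewrite row_mul rowK.
Qed.

Lemma diff0_mem j k : diff C 0 j k \in L.
Proof.
have /(augmentation resC) /(_ k) : exists w, row j (diff C 0) = w *m diff C 0.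
  by exists (delta_mx 0 j); rewrite rowE.
by rewrite mxE.
Qed.

Lemma diff_diff i : diff C i.+1 *m diff C i = 0.
Proof.
apply/row_matrixP => j; rewrite row_mul row0; apply/(exactness resC).
by exists (delta_mx 0 j); rewrite rowE.
Qed.

Lemma lift_degree_preserving i p (x : 'rV[nat]_p)
    (V : 'M_(p, rk C i)) (W : 'M_(p, rk C i.+1)) :
  degree_preserving x (degs C i) V -> V = W *m diff C i ->
  exists2 W', degree_preserving x (degs C i.+1) W' & V = W' *m diff C i.
Proof.
move=> Vx VE; exists (degree0_part x (degs C i.+1) W).
  exact: degree0_part_preserving.
rewrite -(degree0_part_mul _ _ (diff_preserving resC (i := i))) -VE.
by rewrite degree0_part_id.
Qed.

(** If the module in degree i is 0, then by exactness the map into the module in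
    degree i + 1 is onto, that is 1 = W (diff C i.+1) for some W.  Comparing
    constant terms gives 1 = 0, so the module in degree i + 1 is 0. *)
Lemma shift_seq_nilS i : shift_seq C i = [::] -> shift_seq C i.+1 = [::].
Proof.
move/eqP; rewrite shift_seq_nil => /eqP rk_i; apply/eqP.
rewrite shift_seq_nil; case rkS: (rk C i.+1) => [//|r].
have lt0 : (0 < rk C i.+1)%N by rewrite rkS.
have [W WE] : exists W, 1%:M = W *m diff C i.+1.
  apply: lift_rows; apply/matrixP => j k.
  by have := ltn_ord k; rewrite [X in (_ < X)%N -> _]rk_i.
have := congr1 (@constant_terms K n _ _) WE.
rewrite constant_terms1 constant_termsM (diff_minimal resC) mulmx0.
move/matrixP/(_ (Ordinal lt0) (Ordinal lt0)); rewrite !mxE eqxx => /eqP.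
by rewrite oner_eq0.
Qed.

End OneResolution.

Section Comparison.
Variables (L : {pred S}) (C C' : graded_complex).
Hypotheses (idealL : idealr_closed L).
Hypotheses (resC : minimally_resolves L C) (resC' : minimally_resolves L C').

(** [A] and [B] are the components in degree i of comparison maps C -> C' and
    C' -> C.  The next components and the homotopy h with its successor are kept
    under existential quantifiers: this is what is needed to go on from degree i
    to degree i + 1 without choosing the whole chain maps at once. *)
Definition homotopy_inverses i (A : 'M[S]_(rk C i, rk C' i))
    (B : 'M[S]_(rk C' i, rk C i)) :=
  [/\ degree_preserving (degs C i) (degs C' i) A,
      exists A', diff C i *m A = A' *m diff C' i,
      exists B', diff C' i *m B = B' *m diff C i,
      exists h, diff C i *m (A *m B - 1%:M) = diff C i *m h *m diff C i
    & constant_terms (A *m B) = 1%:M].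

(** The comparison theorem.  In degree i + 1, A' B' - 1 and (diff C i) h agree after
    composition with diff C i, so their difference factors through diff C i.+1.
    Hence A' B' - 1 is a sum of two terms with a differential as factor, and
    these differentials have no constant terms. *)
Lemma homotopy_inverses_exist i : exists A B, @homotopy_inverses i A B.
Proof.
elim: i => [|i [A [B [Apres [A' AA'] [B' BB'] [h hE] _]]]].
  have ord_rk0 (j k : 'I_(rk C 0)) : j = k.
    have lt1 (l : 'I_(rk C 0)) : (l < 1)%N by rewrite -(rk0 resC).
    apply/val_inj => /=; move: (lt1 j) (lt1 k).
    by rewrite !ltnS !leqn0 => /eqP -> /eqP ->.
  have AB1 : (const_mx 1 : 'M[S]_(rk C 0, rk C' 0)) *m const_mx 1 = 1%:M.
    apply/matrixP => j k; rewrite !mxE (ord_rk0 j k) eqxx.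
    under eq_bigr do rewrite !mxE mulr1.
    by rewrite sumr_const card_ord (rk0 resC').
  (* both modules have rank 1, so this is the identity of S *)
  exists (const_mx 1), (const_mx 1); split.
  - move=> j k u; rewrite mxE msupp1 inE => /eqP ->.
    by rewrite mdeg0 (degs0 resC) (degs0 resC').
  - apply: lift_rows0 resC' _ _ _ => j k; rewrite mxE; apply: ideal_sum => // l.
    by rewrite mxE mulr1; apply: diff0_mem resC _ _.
  - apply: lift_rows0 resC _ _ _ => j k; rewrite mxE; apply: ideal_sum => // l.
    by rewrite mxE mulr1; apply: diff0_mem resC' _ _.
  - by exists 0; rewrite AB1 subrr !mulmx0 mul0mx.
  - by rewrite AB1 constant_terms1.
have dA_pres : degree_preserving (degs C i.+1) (degs C' i) (diff C i *m A).
  exact: degree_preserving_mul (diff_preserving resC (i := i)) Apres.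
have [{AA'}A' A'pres AA'] := lift_degree_preserving resC' dA_pres AA'.
have [h' h'E] : exists h', A' *m B' - 1%:M - diff C i *m h = h' *m diff C i.+1.
  apply: (lift_rows resC); rewrite !mulmxBl mul1mx -[A' *m B' *m _]mulmxA -BB'.
  by rewrite mulmxA -AA' -mulmxA -hE mulmxBr mulmx1 subrr.
exists A', B'; split=> //.
- apply: (lift_rows resC').
  by rewrite -mulmxA -AA' mulmxA (diff_diff resC) mul0mx.
- apply: (lift_rows resC).
  by rewrite -mulmxA -BB' mulmxA (diff_diff resC') mul0mx.
- exists h'; rewrite -[in RHS]mulmxA -h'E [RHS]mulmxBr [in RHS]mulmxA.
  by rewrite (diff_diff resC) mul0mx subr0.
have -> : A' *m B' = h' *m diff C i.+1 + diff C i *m h + 1%:M.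
  by rewrite -h'E !subrK.
rewrite /constant_terms !map_mxD -!/(constant_terms _) constant_terms1.
by rewrite !constant_termsM !(diff_minimal resC) mulmx0 mul0mx !add0r.
Qed.

(** Since the constant terms of A and B multiply to the identity, row j of A has an
    entry with nonzero constant term, in some column k; A preserves degrees, so
    the generators j of C and k of C' have the same degree. *)
Lemma shift_seq_sub i : {subset shift_seq C i <= shift_seq C' i}.
Proof.
move=> _ /mem_shift_seq [j ->].
have [A [B [Apres _ _ _ AB1]]] := homotopy_inverses_exist i.
have /existsP [k Ajk] : [exists k, (A j k)@_0%MM != 0].
  apply: contraT; rewrite negb_exists => /forallP Aj0.
  have := congr1 (fun M : 'M_(_) => M j j) AB1.
  rewrite constant_termsM !mxE eqxx big1 => [/esym/eqP|k _].
    by rewrite oner_eq0.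
  by rewrite mxE; have := Aj0 k; rewrite negbK => /eqP ->; rewrite mul0r.
apply/mem_shift_seq; exists k.
by rewrite -(Apres j k 0%MM) ?mcoeff_msupp // mdeg0.
Qed.

End Comparison.

Lemma shift_seq_uniq L C C' : idealr_closed L ->
    minimally_resolves L C -> minimally_resolves L C' ->
  forall i, shift_seq C i =i shift_seq C' i.
Proof.
move=> idealL resC resC' i d.
by apply/idP/idP; [apply: shift_seq_sub idealL resC resC' i d
                  | apply: shift_seq_sub idealL resC' resC i d].
Qed.

Section Cone.
Variables (C : graded_complex) (f : S) (d : nat).

(** The mapping cone of multiplication by f, of degree d: in homological degree
    i + 1 it is F_(i+1) (+) F_i(-d).  The sign (-1)^i in the i-th map makes
    consecutive maps compose to 0. *)
Definition cone_rk i := if i is j.+1 then (rk C j.+1 + rk C j)%N else rk C 0.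

Definition cone_degs i : 'rV[nat]_(cone_rk i) :=
  match i with
  | 0 => degs C 0
  | j.+1 => row_mx (degs C j.+1) (map_mx (addn d) (degs C j))
  end.

Definition cone_diff i : 'M[S]_(cone_rk i.+1, cone_rk i) :=
  match i with
  | 0 => col_mx (diff C 0) f%:M
  | j.+1 => block_mx (diff C j.+1) 0 ((-1) ^+ j.+1 * f)%:M (diff C j)
  end.

Definition cone := GradedComplex cone_degs cone_diff.

Lemma shift_seq_cone i :
  shift_seq cone i.+1 =i shift_seq C i.+1 ++ [seq (d + e)%N | e <- shift_seq C i].
Proof.
move=> e; rewrite mem_cat; apply/mem_shift_seq/orP => /= [[j ->]|].
  case: (split_ordP j) => k ->.
    by left; rewrite row_mxEl; apply/mem_shift_seq; exists k.
  right; rewrite row_mxEr mxE; apply: map_f; apply/mem_shift_seq; by exists k.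
case=> [/mem_shift_seq [k ->]|/mapP [_ /mem_shift_seq [k ->] ->]].
  by exists (lshift _ k); rewrite row_mxEl.
by exists (rshift _ k); rewrite row_mxEr mxE.
Qed.

Variable L : {pred S}.
Hypothesis idealL : idealr_closed L.
Hypothesis resC : minimally_resolves L C.
Hypothesis homog_f : f \is d.-homog.
Hypothesis d_gt0 : (0 < d)%N.
Hypothesis regular_f : forall g, f * g \in L -> g \in L.

Lemma cone_diff_preserving i :
  degree_preserving (cone_degs i.+1) (cone_degs i) (cone_diff i).
Proof.
have msupp_f (e : nat) u : u \in msupp ((-1) ^+ e * f) -> mdeg u = d.
  rewrite -signr_odd mulr_sign; case: ifP => _ /(dhomog_mf (d := d)) -> //.
  by rewrite dhomogN.
have msupp_scalar p (g : S) (j k : 'I_p) u :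
    u \in msupp ((g%:M : 'M_p) j k) -> j = k /\ u \in msupp g.
  by rewrite mxE; case: eqP => [->|_]; rewrite ?mulr1n // mulr0n msupp0.
case: i => [|i] j k u; case: (split_ordP j) => {}j ->.
- by rewrite /= col_mxEu row_mxEl; apply: (diff_preserving resC).
- rewrite /= col_mxEd row_mxEr => /msupp_scalar [-> ufsupp].
  by rewrite mxE (msupp_f 0%N u) // mul1r.
- case: (split_ordP k) => {}k ->; rewrite /= ?block_mxEul ?block_mxEur !row_mxEl.
    exact: (diff_preserving resC).
  by rewrite mxE msupp0.
- case: (split_ordP k) => {}k ->; rewrite /= ?block_mxEdl ?block_mxEdr !row_mxEr.
    by rewrite row_mxEl => /msupp_scalar [-> /msupp_f ->]; rewrite mxE.
  by move=> usupp; rewrite !mxE -(diff_preserving resC usupp) addnCA.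
Qed.

Lemma cone_minimal i : constant_terms (cone_diff i) = 0.
Proof.
have f0 : f@_0%MM = 0 by apply: homog_constant_term homog_f.
case: i => [|i]; rewrite /cone_diff /constant_terms.
  rewrite map_col_mx map_scalar_mx /= f0 -!/(constant_terms _) (diff_minimal resC).
  by rewrite raddf0 col_mx0.
rewrite map_block_mx map_scalar_mx map_mx0 -!/(constant_terms _).
by rewrite !(diff_minimal resC) rmorphM /= f0 mulr0 raddf0 block_mx0.
Qed.

(** A vector with entries a_k + q_k f, where the a_k lie in L, is the image of
    (u, v) with v = (q_k) and u a preimage of (a_k) under diff C 0. *)
Lemma cone_augmentation (v : 'rV_(rk C 0)) :
  (exists w, v = w *m cone_diff 0) <-> forall k, v 0 k \in adjoin L [:: f].
Proof.
split=> [[w ->] k|vLf].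
  rewrite -[w]hsubmxK mul_row_col mul_mx_scalar mxE; apply/mem_adjoin1.
  exists ((lsubmx w *m diff C 0) 0 k).
    by apply/(augmentation resC) : k; exists (lsubmx w).
  by exists (rsubmx w 0 k); congr (_ + _); rewrite mxE mulrC.
have /fin_all_exists [q qE] : forall k, exists q, v 0 k - q * f \in L.
  by move=> k; have /mem_adjoin1 [p Lp [q ->]] := vLf k; exists q; rewrite addrK.
have [u uE] : exists u, v - f *: \row_k q k = u *m diff C 0.
  by apply/(augmentation resC) => k; rewrite !mxE mulrC.
exists (row_mx u (\row_k q k)).
by rewrite mul_row_col mul_mx_scalar -uE subrK.
Qed.

(** For a cycle (u, v), the component v is a boundary y (diff C i): in positive
    degree by exactness of C, and in degree 0 because f v has entries in L and f
    is regular.  Then u + s f y is a cycle of C for the sign s, and writing it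
    as a boundary gives the rest. *)
Lemma cone_exactness i (v : 'rV_(cone_rk i.+1)) :
  v *m cone_diff i = 0 <-> exists w, v = w *m cone_diff i.+1.
Proof.
split=> [|[w ->]]; last first.
  rewrite -[w]hsubmxK mul_row_block mulmx0 add0r !mul_mx_scalar.
  case: i v w => [|i] v w.
    rewrite mul_row_col mul_mx_scalar mulmxDl -mulmxA (diff_diff resC) mulmx0 add0r.
    by rewrite -scalemxAl expr1 mulN1r scaleNr addNr.
  rewrite mul_row_block mul_mx_scalar mulmxDl -!mulmxA !(diff_diff resC) !mulmx0 !add0r.
  rewrite -scalemxAl -scalerDl [(-1) ^+ i.+2]exprS mulN1r mulNr addNr.
  by rewrite scale0r row_mx0.
rewrite -[v]hsubmxK; move: (lsubmx v) (rsubmx v) => {v} /= u v uv0.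
have lift s (y : 'rV_(rk C i.+1)) : u *m diff C i + s *: (y *m diff C i) = 0 ->
    exists x, u = x *m diff C i.+1 - s *: y.
  rewrite scalemxAl -mulmxDl => /(exactness resC) [x xE].
  by exists x; rewrite -xE addrK.
case: i u v uv0 lift => [|i] u v.
  rewrite mul_row_col mul_mx_scalar => uv0 lift.
  have [y vE] : exists y, v = y *m diff C 0.
    apply/(augmentation resC) => k; apply: regular_f.
    have := congr1 (fun x : 'rV_(rk C 0) => x 0 k) uv0; rewrite !mxE => /eqP.
    rewrite addrC addr_eq0 => /eqP ->; rewrite -mulN1r; apply: idealMl => //.
    have /(augmentation resC) /(_ k) : exists w, u *m diff C 0 = w *m diff C 0.
      by exists u.
    by rewrite mxE.
  have [|x uE] := lift f y; first by rewrite -vE.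
  exists (row_mx x y); rewrite mul_row_block mulmx0 add0r mul_mx_scalar -vE.
  by rewrite expr1 mulN1r scaleNr -uE.
rewrite mul_row_block mul_mx_scalar mulmx0 add0r => uv0 lift.
have [u0 v0] : u *m diff C i.+1 + ((-1) ^+ i.+1 * f) *: v = 0 /\ v *m diff C i = 0.
  by apply: eq_row_mx; rewrite uv0 row_mx0.
have [y vE] := proj1 (exactness resC v) v0.
have [|x uE] := lift ((-1) ^+ i.+1 * f) y; first by rewrite -vE.
exists (row_mx x y); rewrite mul_row_block mulmx0 add0r mul_mx_scalar -vE.
by rewrite [(-1) ^+ i.+2]exprS mulN1r mulNr scaleNr -uE.
Qed.

Lemma cone_resolves : minimally_resolves (adjoin L [:: f]) cone.
Proof.
split.
- exact: rk0 resC.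
- exact: degs0 resC.
- exact: cone_diff_preserving.
- exact: cone_minimal.
- exact: cone_augmentation.
- exact: cone_exactness.
Qed.

End Cone.

Definition complex_of_shifts (D : seq (seq nat))
    (phi : forall i, 'M[S]_(size (shifts D i.+1), size (shifts D i))) :=
  @GradedComplex (fun i => size (shifts D i))
    (fun i => \row_j nth 0%N (shifts D i) j) phi.

Lemma shift_seq_of_shifts D phi i :
  shift_seq (@complex_of_shifts D phi) i =i shifts D i.
Proof.
move=> d; apply/mem_shift_seq/(nthP 0%N) => /= [[j ->]|[j lt_j <-]].
  by exists j; rewrite ?mxE.
by exists (Ordinal lt_j); rewrite mxE.
Qed.

(** The module in degree 0 has the single shift 0, so the condition on the image
    of the first map carries over to vectors of length 1. *)
Lemma resolution_of_shifts L D : minimal_free_resolution L D ->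
  exists2 C, minimally_resolves L C & forall i, shift_seq C i =i shifts D i.
Proof.
move=> [_ [phi [hom_phi irr_phi img_phi exact_phi]]].
exists (complex_of_shifts phi); last exact: shift_seq_of_shifts.
split=> //=.
- by move=> k; rewrite mxE; case: k => -[].
- by move=> i j k u /hom_phi; rewrite !mxE.
- by move=> i; apply/matrixP => j k; rewrite !mxE; apply: irrelevant_constant_term.
- move=> v; have vE : v = (v 0 0)%:M.
    by apply/rowP => k; rewrite !mxE !ord1.
  split=> [[w wE] k|vL].
    by rewrite ord1; apply/img_phi; exists w; rewrite -wE.
  by have /img_phi [w wE] := vL 0; exists w; rewrite wE.
Qed.

End Resolutions.

(** * Regular sequences *)

Section RegularSequences.
Variables (K : fieldType) (n : nat).
Local Notation S := {mpoly K[n]}.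
Implicit Types (I : {pred S}) (f g : S) (fs : seq S).

Lemma sub_adjoin I fs : {subset I <= adjoin I fs}.
Proof.
move=> g Ig; apply/asboolP; exists g => //; exists (fun=> 0).
by rewrite big1 ?addr0 // => j _; rewrite mul0r.
Qed.

Lemma homog0_const f : f \is 0.-homog -> f = (f@_0%MM)%:MP.
Proof.
move=> f0; apply/mpolyP => u; rewrite mcoeffC.
have [->|u_neq0] := eqVneq u 0%MM; first by rewrite mulr1.
by rewrite mulr0 (dhomog_nemf_coeff f0) //= mdeg_eq0.
Qed.

(** The degree of f is positive: a homogeneous f of degree 0 is a constant, which
    is not 0 because f is regular on S/I <> 0, so (I, f) would not be proper. *)
Lemma regular_sequence_cons I f fs : idealr_closed I ->
    homogeneous_regular_sequence I (f :: fs) ->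
  [/\ exists2 d, f \is d.-homog & (0 < d)%N,
      forall g, f * g \in I -> g \in I,
      1 \notin adjoin I [:: f]
    & homogeneous_regular_sequence (adjoin I [:: f]) fs].
Proof.
move=> idealI [hom_fs reg_fs proper_fs].
have regf g : f * g \in I -> g \in I.
  by have := reg_fs 0%N isT g; rewrite /= adjoin_nil.
have properf : 1 \notin adjoin I [:: f].
  by apply: contra proper_fs; rewrite (adjoin_cons I f fs); apply: sub_adjoin.
split=> //.
  have [d fd] := hom_fs 0%N isT; exists d => //; rewrite lt0n.
  apply/eqP => d0; rewrite /= d0 in fd.
  have fE := homog0_const fd; case/negP: properf; apply/mem_adjoin1.
  exists 0; first exact: ideal0.
  exists (f@_0%MM)^-1%:MP; rewrite add0r {2}fE -mpolyCM mulVf ?mpolyC1 //.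
  apply: contra (ideal1 idealI) => /eqP f0; apply: regf.
  by rewrite mulr1 fE f0 mpolyC0 ideal0.
split=> [i lt_i|i lt_i g|]; last by rewrite -adjoin_cons.
  exact: (hom_fs i.+1).
by have := reg_fs i.+1 lt_i g; rewrite /= adjoin_cons.
Qed.

Lemma within_shift_bounds_regular fs I C s (e : rat) :
    graded_ideal I -> homogeneous_regular_sequence I fs ->
    minimally_resolves I C -> multiplicity I e ->
    within_shift_bounds (shift_seq C) s e ->
  exists C' e',
    [/\ graded_ideal (adjoin I fs), minimally_resolves (adjoin I fs) C',
        multiplicity (adjoin I fs) e'
      & within_shift_bounds (shift_seq C') (s + size fs) e'].
Proof.
elim: fs I C s e => [|f fs IHfs] I C s e gradedI regI resC multI boundsC.
  by exists C, e; rewrite adjoin_nil addn0.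
have idealI := proj1 gradedI.
have [[d fd d_gt0] regf properf regfs] := regular_sequence_cons idealI regI.
rewrite adjoin_cons /= -addSnnS.
apply: (IHfs _ (cone C f d) s.+1 (d%:R * e)) => //.
- exact: adjoin_graded_ideal fd properf.
- exact: cone_resolves.
- exact: multiplicity_adjoin.
apply: within_shift_bounds_cone boundsC.
- exact: shift_seq0 resC.
- exact: shift_seq_nilS resC.
- exact: shift_seq_cone.
Qed.

End RegularSequences.

Theorem theorem1p1 (K : fieldType) (n : nat) (I : {pred {mpoly K[n]}})
    (s m : nat) (f : m.-tuple {mpoly K[n]})
    (D Df : seq (seq nat)) (e ef : rat) :
  graded_ideal I ->
  {subset I <= irrelevant K n} ->
  height I s ->
  homogeneous_regular_sequence I f ->
  minimal_free_resolution I D ->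
  minimal_free_resolution (adjoin I f) Df ->
  multiplicity I e ->
  multiplicity (adjoin I f) ef ->
  (s`!%:R)^-1 * \prod_(1 <= i < s.+1) (min_shift D i)%:R <= e
    /\ e <= (s`!%:R)^-1 * \prod_(1 <= i < s.+1) (max_shift D i)%:R ->
  ((s + m)`!%:R)^-1 * \prod_(1 <= i < (s + m).+1) (min_shift Df i)%:R <= ef
    /\ ef <= ((s + m)`!%:R)^-1
             * \prod_(1 <= i < (s + m).+1) (max_shift Df i)%:R.
Proof.
move=> gradedI _ _ regf /resolution_of_shifts [C resC CD].
move=> /resolution_of_shifts [Cf resCf CfDf] multI multIf boundsD.
have boundsC : within_shift_bounds (shift_seq C) s e.
  by apply: (@eq_within_shift_bounds (shifts D)) => // i d; rewrite CD.
have [C' [e' [gradedIf resC' multIf' bounds']]] :=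
  within_shift_bounds_regular gradedI regf resC multI boundsC.
have idealIf := proj1 gradedIf.
rewrite (multiplicity_uniq idealIf multIf multIf').
rewrite size_tuple in bounds'.
apply: (@eq_within_shift_bounds (shift_seq C')) bounds' => i d.
by rewrite -CfDf (shift_seq_uniq idealIf resC' resCf).
Qed.
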